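(* Let $q\geq 2$ and let $Z_1$ be a tight $q$-matroid with set $\Omega_1$ of skew classes. Assume that each skew class $e\in\Omega_1$ is non-singular and has the form $e=\{e_1,\ldots,e_q\}$. Let $\mathcal Z=\{Z_e:e\in\Omega_1\}$ be a collection of tight multimatroids indexed by $\Omega_1$ having pairwise disjoint ground sets, such that for each $e\in\Omega_1$, $Z_1$ and $Z_e$ align at the non-singular skew class $e$. Let $Z_2$ be a tight multimatroid with a non-singular skew class $a=\{a_1,\ldots,a_q\}$ such that for each $e\in\Omega_1$ the multimatroid $Z_e$ is isomorphic to $Z_2$ via an isomorphism $\phi_e$ with $\phi_e(e)=a$. Let $\Phi=\{\phi_e:e\in\Omega_1\}$ and $U_2'=U(Z_2)-a$. Then \[ Q(Z_1\otimes_\Phi Z_2)=Q\big(Z_1;\{x_{e_i}=\phi_e^{-1}(y_{\phi_e(e_i)})\}_{e\in\Omega_1,\,1\le i\le q},\,t\big),\] where $\{y_u\}_{u\in a}$ is the unique solution to the following system of linear equations in the ring $\mathbb Z[t,\{x_u\}_{u\in U_2'}]$: \begin{align*} Q(Z_2|a_1;\{x_u\}_{u\in U_2'},t)&=ty_{a_1}+y_{a_2}+\cdots+y_{a_q},\\ Q(Z_2|a_2;\{x_u\}_{u\in U_2'},t)&=y_{a_1}+ty_{a_2}+\cdots+y_{a_q},\\ &\ \,\vdots\\ Q(Z_2|a_q;\{x_u\}_{u\in U_2'},t)&=y_{a_1}+y_{a_2}+\cdots+ty_{a_q}. \end{align*}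
   Context: A carrier is a pair $(U,\Omega)$ where $U$ is a finite set (the ground set) and $\Omega$ is a partition of $U$ into non-empty blocks called skew classes; it is a $q$-carrier if every skew class has size $q$. A skew pair is a pair of distinct elements of the same skew class. A subtransversal is a subset of $U$ meeting each skew class at most once; a transversal is a subtransversal of size $|\Omega|$; a near-transversal is a subtransversal of size $|\Omega|-1$. $\mathcal S(\Omega)$ is the set of subtransversals. A multimatroid is a triple $Z=(U,\Omega,r)$ with $(U,\Omega)$ a carrier and $r:\mathcal S(\Omega)\to\mathbb Z_{\ge0}$ such that (R1) for each transversal $T$, the restriction of $r$ to subsets of $T$ is the rank function of a matroid on $T$; (R2) for each subtransversal $S$ and skew pair $\{e_i,e_j\}$ from a skew class disjoint from $S$, $r(S\cup\{e_i\})+r(S\cup\{e_j\})-2r(S)\ge 1$. It is a $q$-matroid if its carrier is a $q$-carrier. $U(Z)$ denotes the ground set and $\mathcal T(Z)$ the set of transversals. The nullity of a subtransversal $S$ is $n(S)=|S|-r(S)$; $S$ is independent if $n(S)=0$; a basis is a maximal independent subtransversal. A multimatroid is determined by its carrier and its bases, via $r(S)=\max_B|B\cap S|$ over bases $B$. An element $u$ is singular if $r(\{u\})=0$; a skew class is singular if it contains a singular element. $Z$ is non-degenerate if every skew class has size at least two (then all bases are transversals). $Z$ is tight if it is non-degenerate and for every near-transversal $S$ there is a (necessarily unique) element $\theta_Z(S)$ in the skew class disjoint from $S$ with $r(S\cup\{\theta_Z(S)\})=r(S)$. An isomorphism of multimatroids is a bijection of ground sets respecting the partitions into skew classes and preserving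 rank. Elementary minor: for $u$ in skew class $e$, $Z|u=(U-e,\Omega-\{e\},r')$ with $r'(S)=r(S\cup\{u\})-r(\{u\})$. $Z_1$ and $Z_2$ align at a non-singular skew class $e$ if $U(Z_1)\cap U(Z_2)=e$ and $e$ is a non-singular skew class of both. If $Z_1,Z_2$ are tight multimatroids (with skew class sets $\Omega_1,\Omega_2$) aligning at a non-singular skew class $e$, the two-sum $Z_1\oplus_2 Z_2$ is the multimatroid with ground set $(U(Z_1)\cup U(Z_2))-e$, skew classes $(\Omega_1\cup\Omega_2)-\{e\}$, in which a transversal $B$ is a basis if and only if $B\cap U(Z_1)$ and $B\cap U(Z_2)$ are independent near-transversals of $Z_1$ and $Z_2$ respectively with $\theta_{Z_1}(B\cap U(Z_1))\ne\theta_{Z_2}(B\cap U(Z_2))$. The two-sum is again a tight multimatroid. Tensor product: with $Z_1,\mathcal Z,Z_2,\Phi$ as in the claim, $Z_1\otimes_\Phi Z_2$ is the multimatroid obtained from $Z_1$ by successively forming the two-sum with $Z_e$ along $e$ for every $e\in\Omega_1$ (this is well defined and independent of the order of the two-sums). Weighted transition polynomial: $Q(Z;\{x_u\}_{u\in U},t)=\sum_{T\in\mathcal T(Z)}t^{n(T)}\prod_{u\in T}x_u$, where the $x_u$ and $t$ are formal variables; $Q(Z)$ abbreviates $Q(Z;\{x_u\}_{u\in U(Z)},t)$. Writing $x_u=y_u$ inside $Q$ means the variable $x_u$ is replaced by $y_u$. For an isomorphism $\phi:Z\to Z'$ of multimatroids, $\phi$ also denotes the ring isomorphism $\mathbb Z[t,\{x_u\}_{u\in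 U(Z)}]\to\mathbb Z[t,\{x_u\}_{u\in U(Z')}]$ with $\phi(x_u)=x_{\phi(u)}$, $\phi(t)=t$. *)

(* Defs.v *)
From HB Require Import structures.
From mathcomp Require Import all_boot all_order all_algebra.
From mathcomp Require Import mpoly.

Set Implicit Arguments.
Unset Strict Implicit.
Unset Printing Implicit Defensive.

Import GRing.Theory.
Local Open Scope ring_scope.

(* All ground sets are subsets of one ambient finite type V, so that distinct
   multimatroids can share a skew class.  [ranked_carrier] is only the data;
   the axioms are in [is_multimatroid].  The values of [rk] on sets that are not
   subtransversals are junk and are never constrained. *)
Record ranked_carrier (V : finType) := RankedCarrier {
  ground : {set V};
  classes : {set {set V}};
  rk : {set V} -> nat
}.

Section Multimatroids.
Variable V : finType.
Implicit Types (Z : ranked_carrier V) (S T A B e : {set V}) (u v : V).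

Definition subtransversal Z S :=
  (S \subset ground Z) && [forall e in classes Z, #|S :&: e| <= 1]%N.

Definition transversal Z T :=
  subtransversal Z T && (#|T| == #|classes Z|).

(* Size #|classes Z| - 1, phrased so that there is none when there are no
   skew classes. *)
Definition near_transversal Z S :=
  subtransversal Z S && (#|S|.+1 == #|classes Z|).

Definition is_matroid_rank T (r : {set V} -> nat) : Prop :=
  [/\ forall A, A \subset T -> r A <= #|A|,
      forall A B, A \subset B -> B \subset T -> r A <= r B
    & forall A B, A \subset T -> B \subset T ->
        r (A :|: B) + r (A :&: B) <= r A + r B]%N.

Definition is_multimatroid Z : Prop :=
  [/\ partition (classes Z) (ground Z),
      forall T, transversal Z T -> is_matroid_rank T (rk Z)
    & forall S e u v, subtransversal Z S -> e \in classes Z ->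
        [disjoint S & e] -> u \in e -> v \in e -> u != v ->
        (2 * rk Z S + 1 <= rk Z (u |: S) + rk Z (v |: S))%N].

Definition nullity Z S : nat := #|S| - rk Z S.

Definition independent Z S := subtransversal Z S && (nullity Z S == 0)%N.

Definition singular Z u := rk Z [set u] == 0%N.

Definition singular_class Z e := [exists u in e, singular Z u].

Definition nondegenerate Z : Prop :=
  forall e, e \in classes Z -> (2 <= #|e|)%N.

Definition tight Z : Prop :=
  [/\ is_multimatroid Z,
      nondegenerate Z
    & forall S e, near_transversal Z S -> e \in classes Z ->
        [disjoint S & e] -> exists2 u, u \in e & rk Z (u |: S) = rk Z S].

(* [Some u] for the unique such u when Z is tight and S a near-transversal. *)
Definition theta Z S : option V :=
  [pick u in ground Z |
    [disjoint S & pblock (classes Z) u] & rk Z (u |: S) == rk Z S].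

(* The subtraction is exact since ranks are monotone within transversals. *)
Definition minor Z u : ranked_carrier V :=
  let e := pblock (classes Z) u in
  RankedCarrier (ground Z :\: e) (classes Z :\ e)
    (fun S => rk Z (u |: S) - rk Z [set u])%N.

Definition align Z1 Z2 e : Prop :=
  [/\ ground Z1 :&: ground Z2 = e,
      e \in classes Z1, e \in classes Z2,
      ~~ singular_class Z1 e & ~~ singular_class Z2 e].

(* A multimatroid is determined by its carrier and its bases. *)
Definition of_bases (U : {set V}) (Omega BB : {set {set V}}) :=
  RankedCarrier U Omega (fun S => \max_(B in BB) #|B :&: S|)%N.

Definition two_sum Z1 Z2 e : ranked_carrier V :=
  let U := (ground Z1 :|: ground Z2) :\: e in
  let Omega := (classes Z1 :|: classes Z2) :\ e in
  let indep_near Z S := independent Z S && near_transversal Z S in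
  of_bases U Omega
    [set B | [&& transversal (RankedCarrier U Omega (fun=> 0%N)) B,
                 indep_near Z1 (B :&: ground Z1),
                 indep_near Z2 (B :&: ground Z2)
               & theta Z1 (B :&: ground Z1) != theta Z2 (B :&: ground Z2)]].

(* Successive two-sums with [Zs e] along e, for e running through the list s;
   s is meant to enumerate the skew classes of Z1, in any order. *)
Definition tensor Z1 (Zs : {set V} -> ranked_carrier V) (s : seq {set V}) :=
  foldl (fun Z e => two_sum Z (Zs e) e) Z1 s.

Definition is_iso Z Z' (f : V -> V) : Prop :=
  [/\ {in ground Z &, injective f},
      f @: ground Z = ground Z',
      [set f @: e | e : {set V} in classes Z] = classes Z'
    & forall S, subtransversal Z S -> rk Z' (f @: S) = rk Z S].

(* Inverse of f : A -> f @: A (identity outside the image). *)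
Definition inv_on (A : {set V}) (f : V -> V) (v : V) : V :=
  odflt v [pick u in A | f u == v].

(* Z[t, {x_v}_(v in V)]: t is the variable of index None, x_v that of index
   Some v. *)
Definition wpoly := {mpoly int[#|{: option V}|]}.

Definition tvar : wpoly := 'X_(enum_rank (None : option V)).
Definition xvar v : wpoly := 'X_(enum_rank (Some v)).

(* p belongs to the subring Z[t, {x_u}_(u in A)]. *)
Definition in_vars (A : {set V}) (p : wpoly) : Prop :=
  forall m, m \in msupp p ->
  forall v, v \notin A -> m (enum_rank (Some v)) = 0%N.

(* The ring endomorphism x_v |-> x_(f v), t |-> t. *)
Definition rename (f : V -> V) (p : wpoly) : wpoly :=
  comp_mpoly
    [tuple 'X_(enum_rank (omap f (enum_val i))) | i < #|{: option V}|] p.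

Definition wtrans (R : comNzRingType) Z (x : V -> R) (t : R) : R :=
  \sum_(T : {set V} | transversal Z T) t ^+ nullity Z T * \prod_(u in T) x u.

Definition Qpoly Z : wpoly := wtrans Z xvar tvar.

(* y solves Q(Z | u) = t y_u + \sum_(v in a, v != u) y_v (u in a), with
   unknowns in Z[t, {x_u}_(u in U(Z) - a)]; only y on a matters. *)
Definition solves_weights Z (a : {set V}) (y : V -> wpoly) : Prop :=
  (forall u, u \in a -> in_vars (ground Z :\: a) (y u)) /\
  (forall u, u \in a ->
     Qpoly (minor Z u) = tvar * y u + \sum_(v in a :\ u) y v).

End Multimatroids.

(* Main.v *)
(** A near-transversal B of Z_2 avoiding the class e is closed by exactly one
    w in e.  In the two-sum along e the rank is then
      r(A + B) = r_1(A + {w}) - 1 + r_2(B),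
    and r_1(A) + r_2(B) for subtransversals B closed by no w.  This yields the
    multimatroid axioms and tightness of the two-sum, and, for transversals,
      n(A + B) = n_1(A + {w}) + n_2(B).
    Summing over the pairs (A, B), forming the two-sum amounts to replacing, in
    the polynomial of Z_1, the weight of each u in e by
      y_u = \sum_B t^n_2(B) \prod_(v in B) x_v,
    the sum over the near-transversals B of Z_2 that avoid e and are closed by u.
    As n(B) in Z_2|u exceeds n_2(B) by one exactly when u closes B, these y_u
    solve the linear system; it has determinant (t - 1)^(q-1) (t - 1 + q). *)
Require Import Defs.
From mathcomp Require Import all_boot all_order all_algebra.
From mathcomp Require Import mpoly zify ring.
(* [transversal] would otherwise refer to [finset.transversal]. *)
Import Defs.
Set Implicit Arguments.
Unset Strict Implicit.
Unset Printing Implicit Defensive.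
Import GRing.Theory.
Local Open Scope ring_scope.

(** * Matroid rank functions on a fixed ground set *)

Section MatroidRank.
Local Open Scope nat_scope.
Variables (V : finType) (T : {set V}) (r : {set V} -> nat).
Hypothesis rM : is_matroid_rank T r.
Implicit Types A B I J : {set V}.

Lemma rank_le_card A : A \subset T -> r A <= #|A|.
Proof. by case: rM => h _ _; apply: h. Qed.

Lemma rankS A B : A \subset B -> B \subset T -> r A <= r B.
Proof. by case: rM => _ h _; apply: h. Qed.

Lemma rank_submod A B : A \subset T -> B \subset T ->
  r (A :|: B) + r (A :&: B) <= r A + r B.
Proof. by case: rM => _ _ h; apply: h. Qed.

Lemma is_matroid_rankS (T' : {set V}) : T' \subset T -> is_matroid_rank T' r.
Proof.
move=> sT; split=> [A sA|A B sAB sB|A B sA sB].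
- exact: rank_le_card (subset_trans sA sT).
- exact: rankS sAB (subset_trans sB sT).
- exact: rank_submod (subset_trans sA sT) (subset_trans sB sT).
Qed.

Lemma rank_setU1_le u A : u |: A \subset T -> r (u |: A) <= (r A).+1.
Proof.
move=> sT; have := sT; rewrite subUset => /andP[su sA].
have := rank_submod su sA; have := rank_le_card su; rewrite cards1; lia.
Qed.

Lemma rank_setU1_ge u A : u |: A \subset T -> r A <= r (u |: A).
Proof. by apply: rankS; apply: subsetUr. Qed.

(** Submodularity for [u |: A] and [B]: their union is [u |: B] and their intersection contains
    [A]. *)
Lemma rank_closureS u A B : A \subset B -> u |: B \subset T ->
  r (u |: A) = r A -> r (u |: B) = r B.
Proof.
move=> sAB sT eqA; have := sT; rewrite subUset => /andP[su sB].
have suA : u |: A \subset T by apply: subset_trans sT; apply: setUS.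
have := rank_submod suA sB.
rewrite -setUA (setUidPr sAB).
have : r A <= r ((u |: A) :&: B).
  by apply: rankS; [rewrite subsetI subsetUr | apply: subset_trans sB; apply: subsetIr].
by have := rank_setU1_ge sT; lia.
Qed.

Lemma rank_span J A : J :|: A \subset T ->
  (forall x, x \in A -> r (x |: J) = r J) -> r (J :|: A) = r J.
Proof.
move=> sT clA.
suff H (s : seq V) : {subset s <= A} -> r (J :|: [set x in s]) = r J.
  by rewrite -(H (enum A)) ?set_enum// => x; rewrite mem_enum.
elim: s => [|y s IHs] sA; first by rewrite set_nil setU0.
have sA' : {subset s <= A} by move=> z zs; apply: sA; rewrite inE zs orbT.
rewrite set_cons setUCA (@rank_closureS y J) ?IHs ?subsetUl//.
  rewrite setUCA -set_cons; apply: subset_trans sT; apply: setUS.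
  by apply/subsetP => z; rewrite inE; apply: sA.
by apply: clA; apply: sA; rewrite inE eqxx.
Qed.

(** Submodularity for [I] and [J :\: I]: each part has rank at most its size, so a deficiency of [I]
    would make [J] deficient. *)
Lemma rank_full_sub I J : I \subset J -> J \subset T -> r J = #|J| -> r I = #|I|.
Proof.
move=> sIJ sJ eqJ.
have sI := subset_trans sIJ sJ; have sD := subset_trans (subsetDl J I) sJ.
have := rank_submod sI sD; rewrite -{1}(setIidPr sIJ) setID.
have -> : I :&: (J :\: I) = set0 by rewrite setIDA setIC -setIDA setDv setI0.
rewrite eqJ.
have := rank_le_card sI; have := rank_le_card sD; rewrite cardsD (setIidPr sIJ).
have := subset_leq_card sIJ; lia.
Qed.

(** Take [J] maximal among the independent sets between [I] and [A]. No element of [A] raises its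
    rank, so [rank_span] gives [r A = r J]. *)
Lemma rank_full_extend I A : I \subset A -> A \subset T -> r I = #|I| ->
  exists J : {set V}, [/\ I \subset J, J \subset A, r J = #|J| & #|J| = r A].
Proof.
move=> sIA sA eqI.
pose P J := (J \subset A) && (r J == #|J|).
have PI : P I by rewrite /P sIA eqI eqxx.
have [J /maxsetP[/andP[sJA /eqP eqJ] maxJ] sIJ] := maxset_exists PI.
exists J; split=> //; rewrite -eqJ -[A in RHS](setUidPr sJA).
rewrite rank_span ?(setUidPr sJA)// => x xA.
have sxJ : x |: J \subset A by rewrite subUset sub1set xA.
have := rank_setU1_ge (subset_trans sxJ sA).
case: (boolP (x \in J)) => [xJ|xJ]; first by rewrite (setUidPr _) ?sub1set.
rewrite leq_eqVlt => /orP[/eqP//|lt].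
have eqxJ : x |: J = J.
  apply: maxJ _ (subsetUr _ _); rewrite /P sxJ eqn_leq.
  by rewrite (rank_le_card (subset_trans sxJ sA)) cardsU1 xJ -eqJ.
by case/negP: xJ; rewrite -eqxJ setU11.
Qed.

End MatroidRank.

(** * Carriers, subtransversals and transversals *)

(** For a class [e] its transversals are the near-transversals of [Z] that avoid [e], still ranked
    by [Z]; the sums over near-transversals range over them. *)
Definition delete_class (V : finType) (Z : ranked_carrier V) (e : {set V}) :=
  RankedCarrier (ground Z :\: e) (classes Z :\ e) (rk Z).

Section Carrier.
Local Open Scope nat_scope.
Variables (V : finType) (Z : ranked_carrier V).
Hypothesis pZ : partition (classes Z) (ground Z).
Implicit Types S T e f : {set V}.

Lemma subtransversalP S :
  reflect (S \subset ground Z /\ forall e, e \in classes Z -> #|S :&: e| <= 1)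
          (subtransversal Z S).
Proof.
apply: (iffP andP) => -[sS /[dup] H]; first by move=> /forall_inP.
by split=> //; apply/forall_inP.
Qed.

Lemma subtransversalS S S' :
  S \subset S' -> subtransversal Z S' -> subtransversal Z S.
Proof.
move=> sS /subtransversalP[sS' H]; apply/subtransversalP; split.
  exact: subset_trans sS'.
by move=> e eZ; apply: leq_trans (H e eZ); apply: subset_leq_card; apply: setSI.
Qed.

Lemma class_sub e : e \in classes Z -> e \subset ground Z.
Proof. by move=> eZ; rewrite -(cover_partition pZ); apply: bigcup_sup eZ. Qed.

Lemma class_eq u e f : e \in classes Z -> f \in classes Z ->
  u \in e -> u \in f -> e = f.
Proof.
move=> eZ fZ ue uf; have tZ := partition_trivIset pZ.
by rewrite -(def_pblock tZ eZ ue) -(def_pblock tZ fZ uf).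
Qed.

Lemma class_neq0 e : e \in classes Z -> e != set0.
Proof. exact: partition_neq0 pZ. Qed.

Lemma mem_ground_class u : u \in ground Z -> exists2 e, e \in classes Z & u \in e.
Proof.
rewrite -(cover_partition pZ) => uc.
by exists (pblock (classes Z) u); rewrite ?pblock_mem ?mem_pblock.
Qed.

Lemma card_sum_classes S :
  S \subset ground Z -> #|S| = \sum_(e in classes Z) #|S :&: e|.
Proof.
move=> sS; have tZ := partition_trivIset pZ.
rewrite -sum1_card (partition_big (pblock (classes Z)) (mem (classes Z))) /=.
  apply: eq_bigr => e eZ; rewrite -sum1_card; apply: eq_bigl => x.
  rewrite inE; case xS: (x \in S) => //=.
  apply/eqP/idP => [<-|xe]; last exact: def_pblock.
  by rewrite mem_pblock (cover_partition pZ) (subsetP sS).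
by move=> x xS; rewrite pblock_mem// (cover_partition pZ) (subsetP sS).
Qed.

(** Each class contributes at most one element to a subtransversal, so the contributions add up to
    the number of classes only if all of them are one. *)
Lemma transversalP T :
  reflect (T \subset ground Z /\ forall e, e \in classes Z -> #|T :&: e| = 1)
          (transversal Z T).
Proof.
apply: (iffP andP) => [[/subtransversalP[sT H] /eqP cT]|[sT H]]; last first.
  split; first by apply/subtransversalP; split=> // e /H ->.
  by rewrite card_sum_classes// (eq_bigr (fun=> 1)) ?sum1_card.
split=> // e eZ; move: cT; rewrite card_sum_classes// -sum1_card.
rewrite (bigD1 e)//= [RHS](bigD1 e)//=.
have := H e eZ.
have : \sum_(i in classes Z | i != e) #|T :&: i| <= \sum_(i in classes Z | i != e) 1.
  by apply: leq_sum => f /andP[/H].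
by set X := bigop _ _ _; set Y := bigop _ _ _; lia.
Qed.

Lemma delete_class_partition e : e \in classes Z ->
  partition (classes (delete_class Z e)) (ground (delete_class Z e)).
Proof. exact: partitionD1. Qed.

Lemma subtransversal_delete e S : e \in classes Z ->
  subtransversal (delete_class Z e) S = subtransversal Z S && [disjoint S & e].
Proof.
move=> eZ; apply/idP/andP => [/andP[]|[/subtransversalP[sS H] dS]].
  rewrite subsetD => /andP[sS dS] /forall_inP H; split=> //.
  apply/subtransversalP; split=> // f fZ.
  have [->|nfe] := eqVneq f e; first by rewrite (disjoint_setI0 dS) cards0.
  by apply: H; rewrite !inE nfe.
apply/andP; split; first by rewrite subsetD sS.
by apply/forall_inP => f; rewrite !inE => /andP[_]; apply: H.
Qed.

Lemma subtransversal_deleteW e S : e \in classes Z ->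
  subtransversal (delete_class Z e) S -> subtransversal Z S.
Proof. by move=> eZ; rewrite subtransversal_delete// => /andP[]. Qed.

Lemma transversal_delete e S : e \in classes Z ->
  transversal (delete_class Z e) S = near_transversal Z S && [disjoint S & e].
Proof.
move=> eZ; rewrite /transversal /near_transversal subtransversal_delete//=.
by rewrite [#|classes Z|](cardsD1 e) eZ add1n eqSS andbAC.
Qed.

Lemma delete_class_notin e S u : u \in e ->
  subtransversal (delete_class Z e) S -> u \notin S.
Proof.
move=> ue /andP[]; rewrite subsetD => /andP[_ dS] _.
by apply/negP => uS; rewrite (disjointFr dS uS) in ue.
Qed.

Lemma subtransversal_setU1 e S u : e \in classes Z -> u \in e -> u \notin S ->
  subtransversal Z (u |: S) = subtransversal (delete_class Z e) S.
Proof.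
move=> eZ ue uS; rewrite subtransversal_delete//.
apply/subtransversalP/andP => [[sS H]|[/subtransversalP[sS H] dS]].
  split.
    apply: (@subtransversalS _ (u |: S)); first exact: subsetUr.
    exact/subtransversalP.
  have := H e eZ; rewrite setIUl (setIidPl _) ?sub1set// cardsU1.
  rewrite inE (negPf uS) /= add1n ltnS leqn0 cards_eq0 => /eqP dS.
  by rewrite -setI_eq0 dS.
have uZ : u \in ground Z := subsetP (class_sub eZ) u ue.
split=> [|f fZ]; first by rewrite subUset sub1set uZ.
rewrite setIUl; have [->|nfe] := eqVneq f e.
  by rewrite (disjoint_setI0 dS) setU0 (leq_trans (subset_leq_card (subsetIl _ _))) ?cards1.
suff -> : [set u] :&: f = set0 by rewrite set0U; apply: H.
apply/eqP; rewrite setI_eq0 disjoints1; apply: contra nfe => uf.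
by rewrite (class_eq fZ eZ uf ue).
Qed.

Lemma transversal_setU1 e S u : e \in classes Z -> u \in e -> u \notin S ->
  transversal Z (u |: S) = transversal (delete_class Z e) S.
Proof.
move=> eZ ue uS; rewrite /transversal (subtransversal_setU1 eZ)// cardsU1 uS.
by rewrite [#|classes Z|](cardsD1 e) eZ !add1n eqSS.
Qed.

Lemma subtransversal_add e S u : e \in classes Z -> u \in e ->
  subtransversal (delete_class Z e) S -> subtransversal Z (u |: S).
Proof.
by move=> eZ ue sS; rewrite (subtransversal_setU1 eZ)// (delete_class_notin ue).
Qed.

Lemma subtransversal_missing S : subtransversal Z S -> ~~ transversal Z S ->
  exists2 e, e \in classes Z & subtransversal (delete_class Z e) S.
Proof.
move=> sS nT; have /subtransversalP[sG H] := sS.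
case: (boolP [exists e in classes Z, [disjoint S & e]]).
  by case/exists_inP=> e eZ dS; exists e; rewrite ?subtransversal_delete// sS.
rewrite negb_exists_in => /forall_inP hit; case/negP: nT.
apply/transversalP; split=> // e eZ; apply/eqP.
by rewrite eqn_leq H//= card_gt0 setI_eq0 hit.
Qed.

Lemma subtransversal_extend S : subtransversal Z S ->
  exists2 T, transversal Z T & S \subset T.
Proof.
move=> sS; have [T /maxsetP[sT maxT] sST] := maxset_exists sS; exists T => //.
apply/idPn => nT; have [e eZ sT'] := subtransversal_missing sT nT.
have /set0Pn[u ue] := class_neq0 eZ.
have uT := delete_class_notin ue sT'.
have := maxT (u |: T) (subtransversal_add eZ ue sT') (subsetUr _ _).
by move=> E; rewrite -E setU11 in uT.
Qed.

End Carrier.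

(** * Independence and bases in multimatroids *)

Section Multimatroid.
Local Open Scope nat_scope.
Variables (V : finType) (Z : ranked_carrier V).
Hypothesis mZ : is_multimatroid Z.
Implicit Types (S T B e f : {set V}) (u v w : V).

Lemma multimatroid_partition : partition (classes Z) (ground Z).
Proof. by case: mZ. Qed.
Let pZ := multimatroid_partition.

Lemma subtransversal_rank S : subtransversal Z S -> is_matroid_rank S (rk Z).
Proof.
move=> /(subtransversal_extend pZ)[T tT].
by apply: is_matroid_rankS; case: mZ => _ h _; apply: h.
Qed.

Lemma rk_le_card S : subtransversal Z S -> rk Z S <= #|S|.
Proof. by move=> /subtransversal_rank/rank_le_card; apply. Qed.

Lemma nullityK S : subtransversal Z S -> nullity Z S + rk Z S = #|S|.
Proof. by move=> /rk_le_card; apply: subnK. Qed.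

Lemma independentE S : independent Z S = subtransversal Z S && (rk Z S == #|S|).
Proof.
rewrite /independent; case: (boolP (subtransversal Z S)) => //= sS.
by have := nullityK sS; lia.
Qed.

Lemma rk_skew S e u v : e \in classes Z -> subtransversal (delete_class Z e) S ->
  u \in e -> v \in e -> u != v ->
  2 * rk Z S + 1 <= rk Z (u |: S) + rk Z (v |: S).
Proof.
move=> eZ sS ue ve uv; case: mZ => _ _ h.
by move: sS; rewrite subtransversal_delete// => /andP[sS dS]; apply: h eZ dS _ _ _.
Qed.

(** Two distinct closing elements would violate (R2), the sum of their ranks being only
    [2 * rk Z S]. *)
Lemma closing_element_unique S e u v : e \in classes Z ->
  subtransversal (delete_class Z e) S -> u \in e -> v \in e ->
  rk Z (u |: S) = rk Z S -> rk Z (v |: S) = rk Z S -> u = v.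
Proof.
move=> eZ sS ue ve equ eqv; apply/eqP/idPn => uv.
by have := rk_skew eZ sS ue ve uv; lia.
Qed.

Lemma rk_add_le S e u : e \in classes Z -> u \in e ->
  subtransversal (delete_class Z e) S -> rk Z S <= rk Z (u |: S) <= (rk Z S).+1.
Proof.
move=> eZ ue sS.
have rM := subtransversal_rank (subtransversal_add pZ eZ ue sS).
by rewrite (rank_setU1_ge rM)// (rank_setU1_le rM).
Qed.

Lemma nonsingular_rk u e : ~~ singular_class Z e -> e \in classes Z -> u \in e ->
  rk Z [set u] = 1.
Proof.
move=> /exists_inPn nsg eZ ue; have := nsg u ue; rewrite /singular.
have su : subtransversal Z [set u].
  rewrite -[[set u]]setU0 (subtransversal_setU1 pZ eZ ue) ?inE//.
  rewrite /subtransversal sub0set; apply/forall_inP => f _.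
  by rewrite set0I cards0.
by have := rk_le_card su; rewrite cards1; lia.
Qed.

Hypothesis ndZ : nondegenerate Z.

(** Non-degeneracy supplies two elements of [e], and by (R2) they cannot both leave the rank
    unchanged. *)
Lemma exists_nonclosing S e : e \in classes Z ->
  subtransversal (delete_class Z e) S ->
  exists2 u, u \in e & rk Z (u |: S) = (rk Z S).+1.
Proof.
move=> eZ sS; have /card_gt1P[u [v [ue ve uv]]] := ndZ eZ.
have := rk_skew eZ sS ue ve uv.
have := rk_add_le eZ ue sS; have := rk_add_le eZ ve sS.
have [/eqP equ|nequ] := boolP (rk Z (u |: S) == (rk Z S).+1).
  by exists u.
by exists v => //; lia.
Qed.

(** A maximal independent set that missed a class could be enlarged there by a non-closing element,
    so it is a transversal. *)
Lemma independent_extend S : subtransversal Z S -> rk Z S = #|S| ->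
  exists B, [/\ transversal Z B, S \subset B & rk Z B = #|B|].
Proof.
move=> sS iS; pose P B := subtransversal Z B && (rk Z B == #|B|).
have PS : P S by rewrite /P sS iS eqxx.
have [B /maxsetP[/andP[sB /eqP iB] maxB] sSB] := maxset_exists PS.
exists B; split=> //; apply/idPn => nT.
have [e eZ sB'] := subtransversal_missing pZ sB nT.
have [u ue equ] := exists_nonclosing eZ sB'.
have uB := delete_class_notin ue sB'.
suff E : u |: B = B by rewrite -E setU11 in uB.
apply: maxB _ (subsetUr _ _); rewrite /P (subtransversal_add pZ eZ)//.
by rewrite equ iB cardsU1 uB eqxx.
Qed.

(* Extend [{w}] to a maximal independent subset of [w |: S], then to a basis,
   and finally remove [w]. *)
Lemma exists_basis_avoiding S e w : e \in classes Z -> w \in e ->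
  rk Z [set w] = 1 -> subtransversal (delete_class Z e) S ->
  exists B, [/\ transversal (delete_class Z e) B, rk Z (w |: B) = #|B|.+1,
    rk Z B = #|B| & rk Z (w |: S) <= #|B :&: S|.+1].
Proof.
move=> eZ we rw sS; have swS := subtransversal_add pZ eZ we sS.
have rM := subtransversal_rank swS.
have swS' : [set w] \subset w |: S by apply: subsetUl.
have [|J [swJ sJ iJ cJ]] := rank_full_extend rM swS' (subxx _).
  by rewrite cards1.
have [B' [tB' sJB iB']] := independent_extend (subtransversalS sJ swS) iJ.
have wB' : w \in B' by apply: (subsetP sJB); rewrite -sub1set.
have wJ : w \in J by rewrite -sub1set.
have eqB : w |: (B' :\ w) = B' by rewrite setD1K.
exists (B' :\ w); have cB : #|B'| = #|B' :\ w|.+1 by rewrite (cardsD1 w) wB'.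
split.
- by rewrite -(transversal_setU1 pZ eZ we) ?eqB// !inE eqxx.
- by rewrite eqB iB'.
- have rB := subtransversal_rank (proj1 (andP tB')).
  exact: (rank_full_sub rB (subD1set _ _) (subxx _) iB').
rewrite -cJ (cardsD1 w) wJ add1n ltnS; apply: subset_leq_card.
rewrite subsetI setSD//; apply/subsetP => x; rewrite 2!inE => /andP[xw /(subsetP sJ)].
by rewrite !inE (negPf xw).
Qed.

End Multimatroid.

(** * Tight multimatroids and closing elements *)

Section Theta.
Local Open Scope nat_scope.
Variables (V : finType) (Z : ranked_carrier V).
Hypothesis tZ : tight Z.
Implicit Types (S T B e f : {set V}) (u v w : V).

Lemma tight_multimatroid : is_multimatroid Z. Proof. by case: tZ. Qed.
Lemma tight_nondegenerate : nondegenerate Z. Proof. by case: tZ. Qed.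
Lemma tight_partition : partition (classes Z) (ground Z).
Proof. exact: multimatroid_partition tight_multimatroid. Qed.
Let mZ := tight_multimatroid.
Let pZ := tight_partition.

Lemma exists_closing S e : e \in classes Z -> transversal (delete_class Z e) S ->
  exists2 u, u \in e & rk Z (u |: S) = rk Z S.
Proof.
move=> eZ; rewrite transversal_delete// => /andP[nS dS].
by case: tZ => _ _; apply.
Qed.

Lemma theta_spec S e : e \in classes Z -> transversal (delete_class Z e) S ->
  exists u, [/\ u \in e, theta Z S = Some u & rk Z (u |: S) = rk Z S].
Proof.
move=> eZ tS; have [v ve eqv] := exists_closing eZ tS.
have tP := partition_trivIset pZ.
have sS : subtransversal (delete_class Z e) S by case/andP: tS.
have dS : [disjoint S & e].
  by move: tS; rewrite transversal_delete// => /andP[].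
rewrite /theta; case: pickP => [u /and3P[uZ du /eqP equ]|/(_ v)].
  exists u; split=> //.
  (* [theta] picks from the whole ground set. As [v |: S] meets every class and [S] misses [f], the
     class [f] of the picked element contains [v], so it is [e]. *)
  have [f fZ uf] := mem_ground_class pZ uZ; move: du.
  rewrite (def_pblock tP fZ uf) => dSf.
  have [<-//|nfe] := eqVneq f e.
  have /subtransversalP H : subtransversal Z (v |: S).
    by apply: subtransversal_add sS.
  have /(transversalP pZ)[_ /(_ f fZ)] : transversal Z (v |: S).
    by rewrite (transversal_setU1 pZ eZ ve) ?(delete_class_notin ve sS).
  rewrite setIUl (disjoint_setI0 dSf) setU0 => c1.
  have /set0Pn[x] : [set v] :&: f != set0 by rewrite -card_gt0 c1.
  rewrite !inE => /andP[/eqP-> vf].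
  by rewrite (class_eq pZ fZ eZ vf ve) eqxx in nfe.
rewrite (subsetP (class_sub pZ eZ) v ve) (def_pblock tP eZ ve) dS /=.
by rewrite eqv eqxx.
Qed.

Lemma theta_Some S e w : e \in classes Z -> transversal (delete_class Z e) S ->
  w \in e -> (theta Z S == Some w) = (rk Z (w |: S) == rk Z S).
Proof.
move=> eZ tS we; have [u [ue -> equ]] := theta_spec eZ tS.
apply/eqP/eqP => [[<-//]|eqw]; congr Some.
exact: (closing_element_unique mZ eZ (proj1 (andP tS))).
Qed.

End Theta.

(** * Preparations for the two-sum *)

Section SubmodularCorrection.
Local Open Scope nat_scope.

(* [a, b, i, u] are the ranks in the first multimatroid of the traces of two sets,
   of their intersection and of their union, [c, d, j, v] those in the second;
   a prime marks the rank after adding the element [w] of the common class. *)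
Lemma submodular_correction (a b i u a' b' i' u' c d j v c' d' j' v' : nat) :
  u + i <= a + b -> u' + i' <= a' + b' -> v + j <= c + d -> v' + j' <= c' + d' ->
  i <= i' -> j <= j' ->
  (a' = a \/ b' = b -> u' = u) -> (c' = c \/ d' = d -> v' = v) ->
  (u + v) + (i + j) + ((a' == a) && (c' == c)) + ((b' == b) && (d' == d))
    <= (a + c) + (b + d) + ((u' == u) && (v' == v)) + ((i' == i) && (j' == j)).
Proof.
move=> h1 h2 h3 h4 h5 h6 hu hv.
have [ea|_] := eqVneq a' a; have [eb|_] := eqVneq b' b;
have [ec|_] := eqVneq c' c; have [ed|_] := eqVneq d' d => /=; try lia.
all: rewrite ?(hu (or_introl ea)) ?(hu (or_intror eb)) ?(hv (or_introl ec))
  ?(hv (or_intror ed)) ?eqxx /=; lia.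
Qed.

End SubmodularCorrection.

Lemma partitionU (V : finType) (P Q : {set {set V}}) (D E : {set V}) :
  partition P D -> partition Q E -> [disjoint D & E] -> partition (P :|: Q) (D :|: E).
Proof.
move=> /and3P[/eqP cP tP nP] /and3P[/eqP cQ tQ nQ] dDE.
apply/and3P; split.
- by rewrite /cover bigcup_setU -/(cover P) -/(cover Q) cP cQ.
- by apply: trivIsetU => //; rewrite cP cQ.
- by rewrite inE negb_or nP.
Qed.

(** An equality of records, not just an isomorphism: what is proved for the classes of the left
    summand transfers to the right one by rewriting. *)
Lemma two_sumC (V : finType) (Z1 Z2 : ranked_carrier V) e :
  two_sum Z1 Z2 e = two_sum Z2 Z1 e.
Proof.
rewrite /two_sum setUC (setUC (classes Z1)); congr of_bases.
by apply/setP => B; rewrite !inE eq_sym; congr (_ && _); rewrite andbCA.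
Qed.

Lemma alignC (V : finType) (Z1 Z2 : ranked_carrier V) e :
  align Z1 Z2 e -> align Z2 Z1 e.
Proof. by case=> *; split; rewrite // setIC. Qed.

(** * The two-sum: bases, rank formula, multimatroid axioms and tightness *)

Section TwoSum.
Local Open Scope nat_scope.
Variables (V : finType) (Z1 Z2 : ranked_carrier V) (e : {set V}).
Hypotheses (t1 : tight Z1) (t2 : tight Z2) (al : align Z1 Z2 e).
Implicit Types (A B S T X Y f : {set V}) (u v w : V).

Notation P := (two_sum Z1 Z2 e).
Notation D1 := (delete_class Z1 e).
Notation D2 := (delete_class Z2 e).

Let m1 := tight_multimatroid t1.
Let m2 := tight_multimatroid t2.
Let p1 := tight_partition t1.
Let p2 := tight_partition t2.
Let e1 : e \in classes Z1. Proof. by case: al. Qed.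
Let e2 : e \in classes Z2. Proof. by case: al. Qed.
Let rk1 u : u \in e -> rk Z1 [set u] = 1.
Proof. by case: al => _ _ _ n _; apply: nonsingular_rk. Qed.
Let rk2 u : u \in e -> rk Z2 [set u] = 1.
Proof. by case: al => _ _ _ _ n; apply: nonsingular_rk. Qed.

Lemma align_disjoint : [disjoint ground D1 & ground D2].
Proof.
have [E _ _ _ _] := al; rewrite -setI_eq0 /= -setDIl E setDv; exact: eqxx.
Qed.

Lemma two_sum_ground : ground P = ground D1 :|: ground D2.
Proof. exact: setDUl. Qed.

Lemma two_sum_classes : classes P = classes D1 :|: classes D2.
Proof. exact: setDUl. Qed.

Lemma two_sum_partition : partition (classes P) (ground P).
Proof.
rewrite two_sum_ground two_sum_classes.
by apply: partitionU align_disjoint; apply: delete_class_partition.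
Qed.

(** The two ground sets meet only in [e], which [B] avoids. *)
Lemma setI_ground1 A B : A \subset ground D1 -> B \subset ground D2 ->
  (A :|: B) :&: ground Z1 = A.
Proof.
move=> sA sB; rewrite setIUl (setIidPl (subset_trans sA (subsetDl _ _))).
suff -> : B :&: ground Z1 = set0 by rewrite setU0.
apply/setP=> x; rewrite !inE; apply/andP => -[xB x1].
have := subsetP sB x xB; rewrite !inE => /andP[/negP xe x2]; apply: xe.
by have [<- _ _ _ _] := al; rewrite inE x1.
Qed.

Lemma setI_ground2 A B : A \subset ground D1 -> B \subset ground D2 ->
  (A :|: B) :&: ground Z2 = B.
Proof.
move=> sA sB; rewrite setIUl [B :&: _](setIidPl (subset_trans sB (subsetDl _ _))).
suff -> : A :&: ground Z2 = set0 by rewrite set0U.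
apply/setP=> x; rewrite !inE; apply/andP => -[xA x2].
have := subsetP sA x xA; rewrite !inE => /andP[/negP xe x1]; apply: xe.
by have [<- _ _ _ _] := al; rewrite inE x1.
Qed.

Lemma two_sum_split S : S \subset ground P ->
  [/\ S :&: ground Z1 \subset ground D1, S :&: ground Z2 \subset ground D2 &
      S = (S :&: ground Z1) :|: (S :&: ground Z2)].
Proof.
rewrite subsetD => /andP[sS dS]; split.
- by rewrite subsetD subsetIr (disjointWl _ dS)// subsetIl.
- by rewrite subsetD subsetIr (disjointWl _ dS)// subsetIl.
- by rewrite -setIUr (setIidPl sS).
Qed.

Lemma setI_class1 A B f : A \subset ground D1 -> B \subset ground D2 ->
  f \in classes D1 -> (A :|: B) :&: f = A :&: f.
Proof.
move=> sA sB; rewrite !inE => /andP[_ fZ].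
by rewrite -[in LHS](setIidPr (class_sub p1 fZ)) setIA (setI_ground1 sA sB).
Qed.

Lemma setI_class2 A B f : A \subset ground D1 -> B \subset ground D2 ->
  f \in classes D2 -> (A :|: B) :&: f = B :&: f.
Proof.
move=> sA sB; rewrite !inE => /andP[_ fZ].
by rewrite -[in LHS](setIidPr (class_sub p2 fZ)) setIA (setI_ground2 sA sB).
Qed.

Lemma subtransversal_two_sum A B : A \subset ground D1 -> B \subset ground D2 ->
  subtransversal P (A :|: B) = subtransversal D1 A && subtransversal D2 B.
Proof.
move=> sA sB; apply/subtransversalP/andP => [[_ H]|[/subtransversalP[_ H1] /subtransversalP[_ H2]]].
  split; apply/subtransversalP; split=> // f fD.
    by rewrite -(setI_class1 sA sB fD) H// two_sum_classes inE fD.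
  by rewrite -(setI_class2 sA sB fD) H// two_sum_classes inE fD orbT.
split=> [|f]; first by rewrite two_sum_ground setUSS.
rewrite two_sum_classes => /setUP[] fD.
  by rewrite (setI_class1 sA sB fD) H1.
by rewrite (setI_class2 sA sB fD) H2.
Qed.

Lemma transversal_two_sum A B : A \subset ground D1 -> B \subset ground D2 ->
  transversal P (A :|: B) = transversal D1 A && transversal D2 B.
Proof.
move=> sA sB.
have pD1 := delete_class_partition p1 e1; have pD2 := delete_class_partition p2 e2.
apply/(transversalP two_sum_partition)/andP => [[_ H]|].
  split; [apply/(transversalP pD1)|apply/(transversalP pD2)]; split=> // f fD.
    by rewrite -(setI_class1 sA sB fD) H// two_sum_classes inE fD.
  by rewrite -(setI_class2 sA sB fD) H// two_sum_classes inE fD orbT.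
case=> /(transversalP pD1)[_ H1] /(transversalP pD2)[_ H2].
split=> [|f]; first by rewrite two_sum_ground setUSS.
rewrite two_sum_classes => /setUP[] fD.
  by rewrite (setI_class1 sA sB fD) H1.
by rewrite (setI_class2 sA sB fD) H2.
Qed.

Lemma subtransversal_two_sumP S : subtransversal P S ->
  exists A B, [/\ subtransversal D1 A, subtransversal D2 B & S = A :|: B].
Proof.
move=> sS; have [sG _] := andP sS; have [sA sB E] := two_sum_split sG.
exists (S :&: ground Z1), (S :&: ground Z2).
by move: sS; rewrite {1}E subtransversal_two_sum// => /andP[].
Qed.

(** The two traces of a basis of the two-sum. The last clause expresses [theta Z1 A != theta Z2 B]
    without [theta]: no [w] closes both sides. *)
Definition two_sum_basis_pair A B :=
  [/\ transversal D1 A, transversal D2 B, rk Z1 A = #|A|, rk Z2 B = #|B| &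
      forall w, w \in e -> rk Z1 (w |: A) = #|A| -> rk Z2 (w |: B) = #|B| -> False].

Lemma two_sum_theta_neq A B : transversal D1 A -> transversal D2 B ->
  (theta Z1 A != theta Z2 B) =
  [forall w in e, ~~ ((rk Z1 (w |: A) == rk Z1 A) && (rk Z2 (w |: B) == rk Z2 B))].
Proof.
move=> tA tB; have [w [we E /eqP cw]] := theta_spec t2 e2 tB.
rewrite E (theta_Some t1 e1 tA we).
apply/idP/forall_inP => [nw v ve|/(_ w we)]; last by rewrite cw andbT.
apply/negP => /andP[/[swap]]; rewrite -(theta_Some t2 e2 tB ve) E => /eqP[<-].
by rewrite (negPf nw).
Qed.

Lemma two_sum_rk_ge A B S : two_sum_basis_pair A B ->
  #|A :&: S| + #|B :&: S| <= rk P S.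
Proof.
case=> tA tB iA iB th.
have [[sA _] [sB _]] := (andP tA, andP tB).
have [gA _] := andP sA; have [gB _] := andP sB.
have := tA; have := tB; rewrite !transversal_delete// => /andP[nB _] /andP[nA _].
have -> : #|A :&: S| + #|B :&: S| = #|(A :|: B) :&: S|.
  suff I0 : A :&: S :&: (B :&: S) = set0 by rewrite setIUl cardsU I0 cards0 subn0.
  apply: disjoint_setI0; apply: disjointW align_disjoint.
    exact: subset_trans (subsetIl _ _) gA.
  exact: subset_trans (subsetIl _ _) gB.
apply: (@leq_bigmax_cond _ _ (fun B => #|B :&: S|)).
rewrite inE (setI_ground1 gA gB) (setI_ground2 gA gB) !independentE//.
rewrite iA iB !eqxx nA nB (subtransversal_deleteW e1)//.
rewrite (subtransversal_deleteW e2)// two_sum_theta_neq//=.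
(* [two_sum] tests transversality on its carrier with rank zero; this is convertible to
   [transversal P], which looks only at the carrier. *)
rewrite [X in X && _](_ : _ = true); last first.
  by have := transversal_two_sum gA gB; rewrite tA tB.
apply/forall_inP => w we; apply/negP => /andP[/eqP E1 /eqP E2].
by apply: (th w we); rewrite ?E1 ?E2.
Qed.

Lemma two_sum_rk_le S n :
  (forall A B, two_sum_basis_pair A B -> #|A :&: S| + #|B :&: S| <= n) ->
  rk P S <= n.
Proof.
move=> H; apply/bigmax_leqP => C.
rewrite inE => /and4P[tC iC1 iC2 thC].
have tPC : transversal P C := tC.
have [sG _] := andP (proj1 (andP tPC)); have [sA sB E] := two_sum_split sG.
move: tPC; rewrite E transversal_two_sum// => /andP[tA tB].
move: iC1 iC2 thC; rewrite !independentE// => /andP[/andP[_ /eqP iA] _].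
move=> /andP[/andP[_ /eqP iB] _]; rewrite two_sum_theta_neq// => /forall_inP th.
rewrite setIUl; apply: leq_trans (H _ _ _); last first.
  split; [exact: tA|exact: tB|exact: iA|exact: iB|].
  by move=> w we E1 E2; have := th w we; rewrite E1 E2 iA iB !eqxx.
by rewrite cardsU leq_subr.
Qed.

Lemma indep_meet_le (Z : ranked_carrier V) A S :
  is_multimatroid Z -> e \in classes Z ->
  transversal (delete_class Z e) A -> rk Z A = #|A| ->
  subtransversal (delete_class Z e) S ->
  #|A :&: S| <= rk Z S.
Proof.
move=> mZ eZ tA iA sS; have pZ := multimatroid_partition mZ.
have sA := subtransversal_deleteW eZ (proj1 (andP tA)).
rewrite -(rank_full_sub (subtransversal_rank mZ sA) (subsetIl A S) (subxx _) iA).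
apply: (rankS (subtransversal_rank mZ (subtransversal_deleteW eZ sS))) => //.
exact: subsetIr.
Qed.

(** Choose [A'] not closed by [w] and meeting [A] in at least [rk Z1 (w |: A) - 1] elements. Its
    closing element [v] differs from [w], so it raises the rank of [B]. Choose [B'] not closed by
    [v] and meeting [B] in at least [rk Z2 B] elements. Only [v] closes [A'], so this is a basis
    pair. *)
Lemma two_sum_rk_lower A B w :
  subtransversal D1 A -> subtransversal D2 B -> w \in e ->
  (forall v, v \in e -> v != w -> rk Z2 (v |: B) = (rk Z2 B).+1) ->
  rk Z1 (w |: A) + rk Z2 B <= (rk P (A :|: B)).+1.
Proof.
move=> sA sB we H.
have [A' [tA' iwA' iA' cA]] :=
  exists_basis_avoiding m1 (tight_nondegenerate t1) e1 we (rk1 we) sA.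
have [v [ve _ cv]] := theta_spec t1 e1 tA'.
have nvw : v != w by apply/eqP => E; move: iwA'; rewrite -E cv iA' => /n_Sn.
have [B' [tB' ivB' iB' cB]] :=
  exists_basis_avoiding m2 (tight_nondegenerate t2) e2 ve (rk2 ve) sB.
have bp : two_sum_basis_pair A' B'.
  split=> // u ue cu1 cu2.
  have uv : u = v.
    by apply: (closing_element_unique m1 e1 (proj1 (andP tA'))) => //; rewrite cu1.
  by move: cu2; rewrite uv ivB' => /esym/n_Sn.
have := two_sum_rk_ge (A :|: B) bp.
have : #|A' :&: A| <= #|A' :&: (A :|: B)|.
  by apply: subset_leq_card; rewrite setIS// subsetUl.
have : #|B' :&: B| <= #|B' :&: (A :|: B)|.
  by apply: subset_leq_card; rewrite setIS// subsetUr.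
by move: cA cB (H v ve nvw); clear; lia.
Qed.

Lemma basis_pair_meet A B A' B' : two_sum_basis_pair A' B' ->
  A \subset ground D1 -> B \subset ground D2 ->
  (A' :&: (A :|: B) = A' :&: A) * (B' :&: (A :|: B) = B' :&: B).
Proof.
case=> /andP[/andP[gA' _] _] /andP[/andP[gB' _] _] _ _ _ gA gB; split.
  rewrite -{1}(setI_ground1 gA' (sub0set _)) setU0 -setIA [ground _ :&: _]setIC.
  by rewrite (setI_ground1 gA gB).
rewrite -{1}(setI_ground2 (sub0set _) gB') set0U -setIA [ground _ :&: _]setIC.
by rewrite (setI_ground2 gA gB).
Qed.

(** By (R2) no other element of [e] closes [B], so [two_sum_rk_lower] gives one inequality. For the
    other, a basis pair either meets [B] in fewer than [rk Z2 B] elements, or has [B'] closed by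
    [w]; then [w] does not close [A'], and [w |: (A' :&: A)] is an independent subset of
    [w |: A]. *)
Lemma two_sum_rk_closed A B w :
  subtransversal D1 A -> subtransversal D2 B -> w \in e ->
  rk Z2 (w |: B) = rk Z2 B -> (rk P (A :|: B)).+1 = rk Z1 (w |: A) + rk Z2 B.
Proof.
move=> sA sB we cw; apply/eqP; rewrite eqn_leq; apply/andP; split; last first.
  apply: two_sum_rk_lower => // v ve vw.
  have := rk_skew m2 e2 sB ve we vw; have := rk_add_le m2 e2 ve sB.
  by rewrite cw; clear; lia.
have awA := rk_add_le m1 e1 we sA.
have rw := rk1 we; have pos : 0 < rk Z1 (w |: A).
  have rM := subtransversal_rank m1 (subtransversal_add p1 e1 we sA).
  by rewrite -rw; apply: (rankS rM (subsetUl _ _)).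
suff : rk P (A :|: B) <= (rk Z1 (w |: A) + rk Z2 B).-1 by move: pos; clear; lia.
apply: two_sum_rk_le => A' B' bp; have [tA' tB' iA' iB' th] := bp.
rewrite !(basis_pair_meet bp (proj1 (andP sA)) (proj1 (andP sB))).
have l1 := indep_meet_le m1 e1 tA' iA' sA.
have l2 := indep_meet_le m2 e2 tB' iB' sB.
have sA' := proj1 (andP tA'); have sB' := proj1 (andP tB').
case: (ltngtP #|B' :&: B| (rk Z2 B)) l2 => // [|eqB _]; first by move: l1 awA; clear; lia.
have swB' := subtransversal_add p2 e2 we sB'.
have swA' := subtransversal_add p1 e1 we sA'.
have rMB := subtransversal_rank m2 swB'.
(* [B' :&: B] has the rank of [B], so [w] does not raise it; by [rank_closureS], [w] then closes the
   larger set [B']. *)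
have cB' : rk Z2 (w |: B') = #|B'|.
  rewrite -iB'; apply: (rank_closureS rMB (subsetIl B' B)) => //.
  have iBB : rk Z2 (B' :&: B) = rk Z2 B.
    rewrite -eqB; apply: (rank_full_sub rMB (subsetIl _ _) (subsetUr _ _)).
    exact: iB'.
  have := subtransversal_rank m2 (subtransversal_add p2 e2 we sB).
  move=> /rankS - /(_ (w |: (B' :&: B)) (w |: B) (setUS _ (subsetIr _ _)) (subxx _)).
  by move: (rank_setU1_ge rMB (setUS _ (subsetIl B' B))) iBB cw; clear; lia.
have iwA' : rk Z1 (w |: A') = #|w |: A'|.
  have := rk_add_le m1 e1 we sA'; rewrite cardsU1 (delete_class_notin we sA').
  have nc : rk Z1 (w |: A') <> #|A'| by move/(th w we); apply.
  by move: nc; rewrite iA'; clear; lia.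
have rMA := subtransversal_rank m1 swA'.
have := rank_full_sub rMA (setUS [set w] (subsetIl A' A)) (subxx _) iwA'.
rewrite cardsU1 inE (negPf (delete_class_notin we sA')) /= => iwAA.
have := subtransversal_rank m1 (subtransversal_add p1 e1 we sA).
move=> /rankS - /(_ (w |: (A' :&: A)) (w |: A) (setUS _ (subsetIr _ _)) (subxx _)).
by move: eqB iwAA; clear; lia.
Qed.

(** Above, each side bounds its own intersection. Below, take a [w] that raises the rank of [A]: the
    extra unit cancels the successor in [two_sum_rk_lower]. *)
Lemma two_sum_rk_free A B : subtransversal D1 A -> subtransversal D2 B ->
  (forall w, w \in e -> rk Z2 (w |: B) != rk Z2 B) ->
  rk P (A :|: B) = rk Z1 A + rk Z2 B.
Proof.
move=> sA sB H; apply/eqP; rewrite eqn_leq; apply/andP; split.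
  apply: two_sum_rk_le => A' B' bp; have [tA' tB' iA' iB' th] := bp.
  rewrite !(basis_pair_meet bp (proj1 (andP sA)) (proj1 (andP sB))).
  have := indep_meet_le m1 e1 tA' iA' sA.
  have := indep_meet_le m2 e2 tB' iB' sB.
  by clear; lia.
have [w we Ew] := exists_nonclosing m1 (tight_nondegenerate t1) e1 sA.
have := @two_sum_rk_lower A B w sA sB we; rewrite Ew addSn ltnS; apply.
by move=> v ve _; have := H v ve; have := rk_add_le m2 e2 ve sB; clear; lia.
Qed.

(** An element closing a subset of [B] also closes [B], hence is [w]. So the closed and the free
    formula merge into one with a single fixed [w]: the ranks of the traces add up, less one exactly
    when [w] is in the closure of both. *)
Lemma two_sum_rk_transversal A B X w :
  subtransversal D1 A -> transversal D2 B -> w \in e -> rk Z2 (w |: B) = rk Z2 B ->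
  X \subset A :|: B ->
  rk P X + ((rk Z1 (w |: (X :&: A)) == rk Z1 (X :&: A))
         && (rk Z2 (w |: (X :&: B)) == rk Z2 (X :&: B)))
  = rk Z1 (X :&: A) + rk Z2 (X :&: B).
Proof.
move=> sA tB we cw sX; have sB := proj1 (andP tB).
have sXA := subtransversalS (subsetIr X A) sA.
have sXB := subtransversalS (subsetIr X B) sB.
have -> : rk P X = rk P ((X :&: A) :|: (X :&: B)) by rewrite -setIUr (setIidPl sX).
have [/eqP cXB|ncXB] := boolP (rk Z2 (w |: (X :&: B)) == _).
  have := two_sum_rk_closed sXA sXB we cXB; have := rk_add_le m1 e1 we sXA.
  by rewrite andbT; case: eqP; clear; lia.
rewrite andbF addn0; apply: two_sum_rk_free => // v ve; apply: contra ncXB => /eqP cv.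
have svB := subtransversal_add p2 e2 ve sB.
have cvB := rank_closureS (subtransversal_rank m2 svB) (subsetIr X B) (subxx _) cv.
by rewrite -(closing_element_unique m2 e2 sB ve we cvB cw) cv.
Qed.

(** The first two axioms hold for any maximum of intersection sizes. For submodularity, [closed]
    collects what each summand contributes to the hypotheses of [submodular_correction]. *)
Lemma two_sum_matroid T : transversal P T -> is_matroid_rank T (rk P).
Proof.
move=> tT; have [A [B [sA sB E]]] := subtransversal_two_sumP (proj1 (andP tT)).
have := tT; rewrite E transversal_two_sum ?(proj1 (andP sA)) ?(proj1 (andP sB))//.
move=> /andP[tA tB]; have [w [we _ cw]] := theta_spec t2 e2 tB.
split=> [X _|X Y sXY _|X Y sX sY].
- by apply/bigmax_leqP => C _; rewrite subset_leq_card// subsetIr.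
- apply/bigmax_leqP => C CB; apply: leq_trans (leq_bigmax_cond _ CB).
  by rewrite subset_leq_card// setIS.
have sU : X :|: Y \subset A :|: B by rewrite subUset sX.
have sI : X :&: Y \subset A :|: B by apply: subset_trans sX; apply: subsetIl.
have := two_sum_rk_transversal sA tB we cw sU.
have := two_sum_rk_transversal sA tB we cw sI.
have := two_sum_rk_transversal sA tB we cw sX.
have := two_sum_rk_transversal sA tB we cw sY.
have mA := subtransversal_rank m1 (subtransversal_add p1 e1 we sA).
have mB := subtransversal_rank m2 (subtransversal_add p2 e2 we sB).
have closed Z C : is_matroid_rank (w |: C) (rk Z) ->
    [/\ rk Z ((X :|: Y) :&: C) + rk Z ((X :&: Y) :&: C) <=
          rk Z (X :&: C) + rk Z (Y :&: C),
        rk Z (w |: ((X :|: Y) :&: C)) + rk Z (w |: ((X :&: Y) :&: C)) <=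
          rk Z (w |: (X :&: C)) + rk Z (w |: (Y :&: C)),
        rk Z ((X :&: Y) :&: C) <= rk Z (w |: ((X :&: Y) :&: C))
      & rk Z (w |: (X :&: C)) = rk Z (X :&: C) \/
        rk Z (w |: (Y :&: C)) = rk Z (Y :&: C) ->
        rk Z (w |: ((X :|: Y) :&: C)) = rk Z ((X :|: Y) :&: C)].
  move=> mC; have wS D : w |: (D :&: C) \subset w |: C by rewrite setUS// subsetIr.
  have wS' D : D :&: C \subset w |: C by apply: subset_trans (wS D); apply: subsetUr.
  split.
  - by rewrite setIUl setIIl; apply: (rank_submod mC).
  - by rewrite setIUl setIIl setUUr (setUIr _ (X :&: C)); apply: (rank_submod mC).
  - exact: (rank_setU1_ge mC (wS _)).
  - by case; apply: (rank_closureS mC) => //; apply: setSI; rewrite (subsetUl, subsetUr).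
have [a1 a2 a3 a4] := closed _ _ mA; have [b1 b2 b3 b4] := closed _ _ mB.
by have := submodular_correction a1 a2 b1 b2 a3 b3 a4 b4; clear; lia.
Qed.

Lemma two_sum_add_left A B f u : subtransversal D1 A -> subtransversal D2 B ->
  f \in classes D1 -> u \in f -> [disjoint A :|: B & f] ->
  forall w, w \in e ->
  [/\ subtransversal D1 (u |: A), subtransversal (delete_class Z1 f) A
    & subtransversal (delete_class Z1 f) (w |: A)].
Proof.
move=> sA sB; rewrite !inE => /andP[nfe f1] uf dS w we.
have dA : [disjoint A & f] by apply: disjointWl dS; apply: subsetUl.
have sA1 := subtransversal_deleteW e1 sA.
have sfA : subtransversal (delete_class Z1 f) A.
  by rewrite subtransversal_delete// sA1.
have due : [disjoint (u |: A) & e].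
  rewrite disjoints_subset subUset sub1set -disjoints_subset inE.
  have -> /= : u \notin e by apply: contra nfe => ue; rewrite (class_eq p1 f1 e1 uf ue).
  by move: sA; rewrite subtransversal_delete// => /andP[].
have dwf : [disjoint (w |: A) & f].
  rewrite disjoints_subset subUset sub1set -disjoints_subset inE dA andbT.
  by apply: contra nfe => wf; rewrite (class_eq p1 f1 e1 wf we).
split=> //; rewrite subtransversal_delete// ?due ?dwf andbT.
  exact: (subtransversal_add p1 f1 uf sfA).
exact: (subtransversal_add p1 e1 we sA).
Qed.

(** If some [w] in [e] closes [B], all three ranks differ by one constant from those in [Z1] with
    [S] replaced by [w |: A]; otherwise the same holds with [A]. Either way (R2) for [Z1]
    applies. *)
Lemma two_sum_skew_left S f u v : subtransversal P S -> f \in classes D1 ->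
  [disjoint S & f] -> u \in f -> v \in f -> u != v ->
  2 * rk P S + 1 <= rk P (u |: S) + rk P (v |: S).
Proof.
move=> /subtransversal_two_sumP[A [B [sA sB ->]]] fD dS uf vf uv.
have f1 : f \in classes Z1 by move: fD; rewrite !inE => /andP[].
(* Only a witness that [e] is non-empty, to apply [two_sum_add_left]. *)
have [x xe _] := exists_nonclosing m1 (tight_nondegenerate t1) e1 sA.
have [suA sfA _] := two_sum_add_left sA sB fD uf dS xe.
have [svA _ _] := two_sum_add_left sA sB fD vf dS xe.
rewrite !setUA.
have [/exists_inP[w we /eqP cw]|] := boolP [exists w in e, rk Z2 (w |: B) == rk Z2 B].
  have [_ _ swA] := two_sum_add_left sA sB fD uf dS we.
  have := two_sum_rk_closed sA sB we cw.
  have := two_sum_rk_closed suA sB we cw.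
  have := two_sum_rk_closed svA sB we cw.
  have := rk_skew m1 f1 swA uf vf uv.
  by rewrite ![w |: (_ |: A)]setUCA; clear; lia.
move=> /exists_inPn nc; rewrite !two_sum_rk_free//.
by have := rk_skew m1 f1 sfA uf vf uv; clear; lia.
Qed.

(** With [w] closing [B], the element of [f] that closes the near-transversal [w |: A] of [Z1] also
    closes [A :|: B], by the rank formula. *)
Lemma two_sum_closing_left S f : transversal (delete_class P f) S ->
  f \in classes D1 -> exists2 u, u \in f & rk P (u |: S) = rk P S.
Proof.
move=> tS fD.
have fP : f \in classes P by rewrite two_sum_classes inE fD.
have f1 : f \in classes Z1 by move: fD; rewrite !inE => /andP[].
have := proj1 (andP tS); rewrite subtransversal_delete// => /andP[sS dS].
have [A [B [sA sB E]]] := subtransversal_two_sumP sS; rewrite {S}E in tS sS dS *.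
have /set0Pn[x xf] := class_neq0 p1 f1.
have [y ye _] := exists_nonclosing m1 (tight_nondegenerate t1) e1 sA.
have [sxA sfA _] := two_sum_add_left sA sB fD xf dS ye.
have xAB : x \notin A :|: B by apply/negP => xS; rewrite (disjointFr dS xS) in xf.
(* Filling the class [f] with [x] gives a transversal of the two-sum; its right trace [B] is then a
   transversal of [D2] and has a closing element. *)
move: tS; rewrite -(transversal_setU1 two_sum_partition fP xf)// setUA.
rewrite transversal_two_sum ?(proj1 (andP sxA)) ?(proj1 (andP sB))// => /andP[txA tB].
have [w [we _ cw]] := theta_spec t2 e2 tB.
have [_ _ swA] := two_sum_add_left sA sB fD xf dS we.
have tw : transversal (delete_class Z1 f) (w |: A).
  rewrite -(transversal_setU1 p1 f1 xf) ?(delete_class_notin xf swA)// setUCA.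
  by rewrite (transversal_setU1 p1 e1 we) ?(delete_class_notin we sxA).
have [u uf cu] := exists_closing t1 f1 tw; exists u => //.
have [suA _ _] := two_sum_add_left sA sB fD uf dS we.
have := two_sum_rk_closed sA sB we cw; rewrite setUA.
by have := two_sum_rk_closed suA sB we cw; rewrite setUCA cu; clear; lia.
Qed.

(** As [e] is non-singular in [Z2], none of its elements closes the empty set, so [two_sum_rk_free]
    gives [u] its rank in [Z1]. This keeps the remaining classes available for further two-sums. *)
Lemma two_sum_nonsingular_left f : f \in classes D1 -> ~~ singular_class Z1 f ->
  ~~ singular_class P f.
Proof.
move=> fD nf; have := fD; rewrite !inE => /andP[nfe f1].
apply/exists_inPn => u uf; rewrite /singular.
have s0 (Z : ranked_carrier V) : subtransversal Z set0.
  by rewrite /subtransversal sub0set; apply/forall_inP => g _; rewrite set0I cards0.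
have [x xe _] := exists_nonclosing m1 (tight_nondegenerate t1) e1 (s0 D1).
have d0 : [disjoint set0 :|: set0 & f] by rewrite setU0 -setI_eq0 set0I.
have [suA _ _] := two_sum_add_left (s0 D1) (s0 D2) fD uf d0 xe.
have := two_sum_rk_free suA (s0 D2); rewrite !setU0 (nonsingular_rk m1 nf f1 uf) => ->.
  by [].
move=> w we; rewrite setU0 rk2//.
by have := rk_le_card m2 (s0 Z2); rewrite cards0; clear; lia.
Qed.

(** The element [w] adds one to the size on the right, which cancels the one lost in the rank
    formula. *)
Lemma nullity_two_sum A B w : transversal D1 A -> transversal D2 B -> w \in e ->
  rk Z2 (w |: B) = rk Z2 B ->
  nullity P (A :|: B) = nullity Z1 (w |: A) + nullity Z2 B.
Proof.
move=> tA tB we cw; have [sA sB] := (proj1 (andP tA), proj1 (andP tB)).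
have := two_sum_rk_closed sA sB we cw.
have := rk_le_card m1 (subtransversal_add p1 e1 we sA).
have := rk_le_card m2 (subtransversal_deleteW e2 sB).
rewrite /nullity cardsU1 (delete_class_notin we sA) cardsU.
have -> : A :&: B = set0.
  apply: disjoint_setI0; apply: disjointW align_disjoint.
    by case/andP: sA.
  by case/andP: sB.
by rewrite cards0 subn0; clear; lia.
Qed.

End TwoSum.

Lemma two_sum_tight (V : finType) (Z1 Z2 : ranked_carrier V) e :
  tight Z1 -> tight Z2 -> align Z1 Z2 e -> tight (two_sum Z1 Z2 e).
Proof.
move=> t1 t2 al; have pP := two_sum_partition t1 t2 al.
have al' := alignC al.
split; first split=> //.
- exact: two_sum_matroid.
- move=> S f u v sS fP dS uf vf uv.
  move: (fP); rewrite two_sum_classes => /setUP[] fD.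
    exact: (two_sum_skew_left t1 t2 al sS fD).
  by rewrite two_sumC in sS *; apply: (two_sum_skew_left t2 t1 al' sS fD).
- move=> f; rewrite two_sum_classes => /setUP[]; rewrite !inE => /andP[_].
    exact: tight_nondegenerate t1 f.
  exact: tight_nondegenerate t2 f.
- move=> S f nS fP dS.
  have tS : transversal (delete_class (two_sum Z1 Z2 e) f) S.
    by rewrite transversal_delete// nS.
  move: (fP); rewrite two_sum_classes => /setUP[] fD.
    exact: (two_sum_closing_left t1 t2 al tS fD).
  by rewrite two_sumC in tS *; apply: (two_sum_closing_left t2 t1 al' tS fD).
Qed.

(** * Weighted sums over transversals of two-sums and minors *)

Section Weights.
Variables (V : finType) (R : comNzRingType).
Implicit Types (Z : ranked_carrier V) (A B S T e f : {set V}) (u v w : V).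
Implicit Types (x : V -> R) (t : R).

(** The [y_u] of the overview, with weights in any commutative ring, because iterated two-sums
    substitute weights into weights. *)
Definition class_weight Z e x t u : R :=
  \sum_(B : {set V} | transversal (delete_class Z e) B && (rk Z (u |: B) == rk Z B))
    t ^+ nullity Z B * \prod_(v in B) x v.

Lemma eq_wtrans Z x x' t : {in ground Z, x =1 x'} -> wtrans Z x t = wtrans Z x' t.
Proof.
move=> eqx; apply: eq_bigr => T /andP[/andP[sT _] _]; congr (_ * _).
by apply: eq_bigr => u uT; apply: eqx; apply: (subsetP sT).
Qed.

Lemma eq_class_weight Z e x x' t u : {in ground Z :\: e, x =1 x'} ->
  class_weight Z e x t u = class_weight Z e x' t u.
Proof.
move=> eqx; apply: eq_bigr => T /andP[/andP[/andP[sT _] _] _]; congr (_ * _).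
by apply: eq_bigr => v vT; apply: eqx; apply: (subsetP sT).
Qed.

Lemma wtrans_class Z e x t : partition (classes Z) (ground Z) -> e \in classes Z ->
  wtrans Z x t = \sum_(u in e) \sum_(A | transversal (delete_class Z e) A)
    t ^+ nullity Z (u |: A) * (x u * \prod_(v in A) x v).
Proof.
move=> pZ eZ; pose F T := t ^+ nullity Z T * \prod_(v in T) x v.
(* The inserted inner sum has exactly one term, for the element of [T] in [e]. *)
transitivity (\sum_(T | transversal Z T) \sum_(u in e | u \in T) F T).
  apply: eq_bigr => T /(transversalP pZ)[_ /(_ e eZ) cT].
  rewrite sumr_const -[LHS]mulr1n; congr (_ *+ _); rewrite -cT.
  by apply: eq_card => u; rewrite !inE andbC.
rewrite (exchange_big_dep (mem e)) /=; last by move=> T u _ /andP[].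
apply: eq_bigr => u ue.
rewrite (reindex_onto (fun A => u |: A) (fun T => T :\ u)); last first.
  by move=> T /and3P[_ _ uT]; rewrite setD1K.
apply: eq_big => [A|A /andP[/and3P[_ _ _] /eqP E]].
  rewrite setU11 ue !andbT; have [uA|uA] := boolP (u \in A).
    rewrite (negbTE (_ : (u |: A) :\ u != A)) ?andbF; last first.
      by apply/eqP => E; rewrite -E !inE eqxx in uA.
    apply/esym/negP => tA; move: (delete_class_notin ue (proj1 (andP tA))).
    by rewrite uA.
  by rewrite setU1K// eqxx andbT (transversal_setU1 pZ eZ ue uA).
by rewrite /F big_setU1 //= -E !inE eqxx.
Qed.

(** By tightness and uniqueness each [B] is closed by exactly one [u] in [e], so it occurs once in
    the double sum. *)
Lemma sum_closing Z e (G : V -> {set V} -> R) (F : {set V} -> R) :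
  tight Z -> e \in classes Z ->
  (forall u B, u \in e -> transversal (delete_class Z e) B ->
     rk Z (u |: B) = rk Z B -> G u B = F B) ->
  \sum_(u in e) \sum_(B | transversal (delete_class Z e) B &&
                          (rk Z (u |: B) == rk Z B)) G u B =
  \sum_(B | transversal (delete_class Z e) B) F B.
Proof.
move=> tZ eZ GF.
rewrite (exchange_big_dep (transversal (delete_class Z e))) /=; last first.
  by move=> u B _ /andP[].
apply: eq_bigr => B tB; have [w [we _ cw]] := theta_spec tZ eZ tB.
rewrite tB (big_pred1 w) ?GF// => u /=; apply/andP/eqP => [[ue /eqP cu]|->]; last first.
  by rewrite cw we eqxx.
have mZ := tight_multimatroid tZ.
exact: (closing_element_unique mZ eZ (proj1 (andP tB))).
Qed.

Lemma wtrans_two_sum Z1 Z2 e x t : tight Z1 -> tight Z2 -> align Z1 Z2 e ->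
  wtrans (two_sum Z1 Z2 e) x t =
  wtrans Z1 (fun u => if u \in e then class_weight Z2 e x t u else x u) t.
Proof.
move=> t1 t2 al; have [_ e1 e2 _ _] := al.
have p1 := tight_partition t1; have dG := align_disjoint al.
rewrite (wtrans_class _ _ p1 e1).
pose F A B := t ^+ nullity (two_sum Z1 Z2 e) (A :|: B) * \prod_(v in A :|: B) x v.
transitivity (\sum_(A | transversal (delete_class Z1 e) A)
              \sum_(B | transversal (delete_class Z2 e) B) F A B).
  rewrite pair_big /= /wtrans.
  rewrite (reindex_onto (fun p => p.1 :|: p.2)
             (fun T => (T :&: ground Z1, T :&: ground Z2))) /=; last first.
    by move=> T /andP[/andP[sT _] _]; have [_ _ <-] := two_sum_split sT.
  apply: eq_bigl => -[A B] /=; apply/andP/andP => [[tAB /eqP[EA EB]]|[tA tB]].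
    have [sA sB _] := two_sum_split (proj1 (andP (proj1 (andP tAB)))).
    rewrite EA in sA; rewrite EB in sB.
    by apply/andP; rewrite -(transversal_two_sum t1 t2 al sA sB).
  have [[/andP[sA _] _] [/andP[sB _] _]] := (andP tA, andP tB).
  rewrite (transversal_two_sum t1 t2 al sA sB) tA tB.
  by rewrite (setI_ground1 al sA sB) (setI_ground2 al sA sB).
rewrite [RHS]exchange_big /=; apply: eq_bigr => A tA.
have [/andP[sA _] _] := andP tA.
(* Sort the sets [B] by their closing element [u]; the nullity formula then splits each summand into
   the factors for [u |: A] in [Z1] and for [B] in [Z2]. *)
rewrite -(sum_closing (G := fun u B =>
   t ^+ nullity Z1 (u |: A) * (t ^+ nullity Z2 B * \prod_(v in B) x v *
   \prod_(v in A) x v)) t2 e2) => [|u B ue tB cu].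
  apply: eq_bigr => u ue; rewrite ue /class_weight.
  rewrite [X in _ * (_ * X)](eq_bigr x) => [|v vA].
    by rewrite mulr_suml mulr_sumr.
  by have := subsetP sA v vA; rewrite !inE => /andP[/negPf ->].
have [/andP[sB _] _] := andP tB.
rewrite /F (nullity_two_sum t1 t2 al tA tB ue cu) exprD.
have -> : \prod_(v in A :|: B) x v = \prod_(v in A) x v * \prod_(v in B) x v.
  rewrite -bigU /=; last exact: disjointW sA sB dG.
  by apply: eq_bigl => v; rewrite !inE.
by rewrite -!mulrA [X in _ * (_ * X)]mulrC.
Qed.

Lemma wtrans_minor Z e u x t : tight Z -> e \in classes Z ->
  ~~ singular_class Z e -> u \in e ->
  wtrans (minor Z u) x t =
  t * class_weight Z e x t u + \sum_(v in e :\ u) class_weight Z e x t v.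
Proof.
move=> tZ eZ nse ue; have mZ := tight_multimatroid tZ; have pZ := tight_partition tZ.
have ru := nonsingular_rk mZ nse eZ ue.
rewrite /wtrans /minor (def_pblock (partition_trivIset pZ) eZ ue).
rewrite -(sum_closing (G := fun v B => (if v == u then t else 1) *
  (t ^+ nullity Z B * \prod_(w in B) x w)) tZ eZ) => [|v B ve tB cv].
  rewrite (big_setD1 u ue) /= eqxx mulr_sumr; congr (_ + _); apply: eq_bigr => v.
  rewrite !inE => /andP[/negPf -> _].
  by apply: eq_bigr => B _; rewrite mul1r.
(* Writing the factor [t] or [1] as a power of [t] leaves an identity between nullities. *)
rewrite mulrA; congr (_ * _); rewrite -[X in X * _]/(if v == u then t ^+ 1 else t ^+ 0).
have sB := proj1 (andP tB); rewrite -[if _ then _ else _]fun_if -exprD; congr (_ ^+ _).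
have := rk_le_card mZ (subtransversal_deleteW eZ sB).
have := rankS (subtransversal_rank mZ (subtransversal_add pZ eZ ue sB))
  (subsetUl [set u] B) (subxx _).
rewrite /nullity /= ru; have [vu|vu] := eqVneq v u; first by rewrite -vu cv; clear; lia.
(* Here [v] closes [B], so [u] raises its rank by one; this offsets the subtracted rank of [u]. *)
have := rk_skew mZ eZ sB ve ue vu; have := rk_add_le mZ eZ ue sB; rewrite cv.
by clear; lia.
Qed.

End Weights.

(** * Iterated two-sums *)

Section Tensor.
Variables (V : finType) (R : comNzRingType).
Implicit Types (Z : ranked_carrier V) (Zs : {set V} -> ranked_carrier V).
Implicit Types (s : seq {set V}) (e f : {set V}) (u : V) (x : V -> R) (t : R).

(** A fold, to follow the recursion of [tensor]; for disjoint classes in [s] at most one test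
    succeeds. *)
Definition tensor_weight Zs x t s u : R :=
  foldr (fun e c => if u \in e then class_weight (Zs e) e x t u else c) (x u) s.

Lemma tensor_weight_out Zs x t s u :
  (forall e, e \in s -> u \notin e) -> tensor_weight Zs x t s u = x u.
Proof.
elim: s => //= e s IHs H; rewrite (negPf (H e _)) ?mem_head//.
by apply: IHs => f fs; apply: H; rewrite inE fs orbT.
Qed.

Lemma tensor_weight_in Zs x t s e u : e \in s -> u \in e ->
  (forall f, f \in s -> u \in f -> f = e) ->
  tensor_weight Zs x t s u = class_weight (Zs e) e x t u.
Proof.
elim: s => //= f s IHs; rewrite inE => es ue H.
have [uf|uf] := boolP (u \in f); first by rewrite (H f) ?mem_head.
apply: IHs => // [|g gs]; last by apply: H; rewrite inE gs orbT.
by case/orP: es => // /eqP ef; rewrite -ef ue in uf.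
Qed.

(** Induction on [s] for all [Z]: the hypotheses on the remaining classes pass from [Z] to its
    two-sum along the first class. *)
Lemma wtrans_tensor Z Zs x t s : tight Z -> uniq s ->
  {in s, forall e, tight (Zs e)} -> {in s, forall e, align Z (Zs e) e} ->
  {in s &, forall e f, e != f -> [disjoint ground (Zs e) & ground (Zs f)]} ->
  wtrans (tensor Z Zs s) x t = wtrans Z (tensor_weight Zs x t s) t.
Proof.
elim: s Z => //= e s IHs Z tZ /andP[es us] tZs alZ dZ.
have es_e : e \in e :: s := mem_head e s.
have in_s f : f \in s -> f \in e :: s by move=> fs; rewrite inE fs orbT.
have te := tZs e es_e; have ale := alZ e es_e.
have pZ := tight_partition tZ.
have [Ge eZ eZe _ _] := ale.
have neq f : f \in s -> f != e by move=> fs; apply: contraNneq es => <-.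
have dis f : f \in s -> [disjoint f & e].
  move=> fs; have [_ fZ _ _ _] := alZ f (in_s f fs).
  rewrite -setI_eq0; apply/eqP/setP => v; rewrite !inE; apply/andP => -[vf ve].
  by have := neq f fs; rewrite (class_eq pZ fZ eZ vf ve) eqxx.
rewrite IHs //.
- rewrite wtrans_two_sum//; apply: eq_wtrans => u uZ.
  (* A later class [f] lies in [ground Z], which meets [ground (Zs e)] only in [e]; so the elements
     of [Zs e] outside [e] keep their weights [x]. *)
  rewrite [RHS]/tensor_weight /=; case: ifP => // ue; apply: eq_class_weight => v /setDP[ve nve].
  apply: tensor_weight_out => f fs; apply: contra nve => vf; rewrite -Ge inE ve andbT.
  have [_ fZ _ _ _] := alZ f (in_s f fs).
  exact: (subsetP (class_sub pZ fZ)).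
- exact: two_sum_tight.
- by move=> f fs; apply: tZs; apply: in_s.
- move=> f fs; have [Gf fZ fZf nf nff] := alZ f (in_s f fs).
  have nfe := neq f fs; have fD : f \in classes (delete_class Z e) by rewrite !inE nfe.
  split=> //; last exact: (two_sum_nonsingular_left tZ te ale fD nf).
    (* [Zs e] and [Zs f] are disjoint, so the ground set of the two-sum meets that of [Zs f] in
       [f :\: e], which is [f]. *)
    rewrite two_sum_ground setIUl /= !setIDAC Gf.
    rewrite (disjoint_setI0 (dZ _ _ es_e (in_s f fs) _)) 1?eq_sym//.
    by rewrite set0D setU0; apply/setDidPl; apply: dis.
  by rewrite two_sum_classes inE fD.
- by move=> f g fs gs; apply: dZ; apply: in_s.
Qed.

End Tensor.

(** * Transport along isomorphisms *)

Section Isomorphism.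
Variables (V : finType) (Z Z' : ranked_carrier V) (phi : V -> V).
Hypotheses (pZ : partition (classes Z) (ground Z)) (iso : is_iso Z Z' phi).
Implicit Types (S f e : {set V}) (u v : V).

Let phiI : {in ground Z &, injective phi}. Proof. by case: iso. Qed.

Lemma iso_setI S e : S \subset ground Z -> e \in classes Z ->
  phi @: S :&: phi @: e = phi @: (S :&: e).
Proof.
move=> /subsetP sS eZ; rewrite imsetI// => u v /sS uZ ve; apply: phiI => //.
exact: (subsetP (class_sub pZ eZ)).
Qed.

Lemma iso_card S : S \subset ground Z -> #|phi @: S| = #|S|.
Proof. by move=> /subsetP sS; apply: card_in_imset => u v /sS uS /sS; apply: phiI. Qed.

Lemma iso_card_classes : #|classes Z'| = #|classes Z|.
Proof.
have [_ _ <- _] := iso; apply: card_in_imset => e f eZ fZ Eef.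
have /set0Pn[u ue] := class_neq0 pZ eZ.
have : phi u \in phi @: f by rewrite -Eef imset_f.
case/imsetP => v vf Euv; apply: (class_eq pZ eZ fZ ue).
rewrite (phiI _ _ Euv) ?(subsetP (class_sub pZ eZ) u ue)//.
exact: (subsetP (class_sub pZ fZ) v vf).
Qed.

Lemma iso_subtransversal S : S \subset ground Z ->
  subtransversal Z' (phi @: S) = subtransversal Z S.
Proof.
move=> sS; have [_ G C _] := iso; rewrite /subtransversal -G -C imsetS// sS /=.
apply/forall_inP/forall_inP => [H e eZ|H _ /imsetP[e eZ ->]].
  have := H _ (imset_f _ eZ); rewrite iso_setI// iso_card//.
  by apply: subset_trans sS; apply: subsetIl.
rewrite iso_setI// iso_card ?H//.
by apply: subset_trans sS; apply: subsetIl.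
Qed.

Lemma iso_transversal_delete S e : S \subset ground Z -> e \in classes Z ->
  transversal (delete_class Z' (phi @: e)) (phi @: S) = transversal (delete_class Z e) S.
Proof.
move=> sS eZ; have [_ G C _] := iso.
have eZ' : phi @: e \in classes Z' by rewrite -C imset_f.
rewrite !transversal_delete// /near_transversal iso_subtransversal// iso_card//.
by rewrite iso_card_classes -!setI_eq0 iso_setI// imset_eq0.
Qed.

Lemma inv_onK : {in ground Z, cancel phi (inv_on (ground Z) phi)}.
Proof.
move=> u uZ; rewrite /inv_on; case: pickP => [v /andP[vZ /eqP Ev]|/(_ u)] /=.
  exact: phiI.
by rewrite uZ eqxx.
Qed.

Lemma inv_on_imsetK S : S \subset ground Z ->
  inv_on (ground Z) phi @: (phi @: S) = S.
Proof.
move=> /subsetP sS; rewrite -imset_comp -[RHS]imset_id; apply: eq_in_imset => u uS.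
by apply: inv_onK; apply: sS.
Qed.

Lemma imset_inv_onK S : S \subset ground Z' -> phi @: (inv_on (ground Z) phi @: S) = S.
Proof.
have [_ <- _ _] := iso => /subsetP sS.
rewrite -imset_comp -[RHS]imset_id; apply: eq_in_imset => _ /sS/imsetP[u uZ ->] /=.
by rewrite inv_onK.
Qed.

Lemma inv_on_sub S : S \subset ground Z' -> inv_on (ground Z) phi @: S \subset ground Z.
Proof.
have [_ <- _ _] := iso => /subsetP sS.
by apply/subsetP => _ /imsetP[_ /sS/imsetP[u uZ ->] ->]; rewrite inv_onK.
Qed.

(** The sets summed over correspond under [phi], and composing [x] with the inverse gives each
    element of [Z'] the weight of its preimage. *)
Lemma class_weight_iso (R : comNzRingType) (x : V -> R) t e u :
  e \in classes Z -> u \in e ->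
  class_weight Z' (phi @: e) (x \o inv_on (ground Z) phi) t (phi u) =
  class_weight Z e x t u.
Proof.
move=> eZ ue; have [_ _ _ rkE] := iso.
have sG Y f B : transversal (delete_class Y f) B -> B \subset ground Y.
  by move=> /andP[/andP[sB _] _]; apply: subset_trans sB (subsetDl _ _).
have rkS S : transversal (delete_class Z e) S ->
    rk Z' (phi @: S) = rk Z S /\ rk Z' (phi u |: phi @: S) = rk Z (u |: S).
  move=> /andP[tS _]; rewrite -imsetU1 !rkE//.
    exact: subtransversal_add tS.
  exact: subtransversal_deleteW tS.
rewrite /class_weight.
rewrite (reindex_onto (fun S => phi @: S) (fun S => inv_on (ground Z) phi @: S)) /=;
  last by move=> B /andP[/sG/imset_inv_onK].
apply: eq_big => [S|S /andP[/andP[tS' _] /eqP E]].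
  have [sS|nS] := boolP (S \subset ground Z).
    rewrite iso_transversal_delete// inv_on_imsetK// eqxx andbT.
    by case tS: (transversal _ S) => //=; have [-> ->] := rkS S tS.
  (* A set [S] outside the ground set is excluded by the round trip, since [inv_on] maps subsets of
     [ground Z'] into [ground Z]. *)
  rewrite (contraNF (@sG _ _ _) nS) andFb; apply/negP => /andP[/andP[tS' _] /eqP E].
  by rewrite -E inv_on_sub ?(sG _ _ _ tS') in nS.
have sS : S \subset ground Z by rewrite -E inv_on_sub// (sG _ _ _ tS').
have tS : transversal (delete_class Z e) S by rewrite -iso_transversal_delete.
rewrite /nullity iso_card// (proj1 (rkS S tS)); congr (_ * _).
rewrite big_imset /=; last by move=> v w /(subsetP sS) vZ /(subsetP sS); apply: phiI.
by apply: eq_bigr => v /(subsetP sS) vZ; rewrite inv_onK.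
Qed.

End Isomorphism.

(** * Polynomials, renaming of variables and the linear system *)

Section Polynomials.
Variable V : finType.
Implicit Types (A : {set V}) (p q : wpoly V) (u v : V) (f : V -> V).

Lemma in_vars_0 A : in_vars A (0 : wpoly V).
Proof. by move=> m; rewrite msupp0. Qed.

Lemma in_vars_1 A : in_vars A (1 : wpoly V).
Proof. by move=> m; rewrite msupp1 inE => /eqP -> v _; rewrite mnm0E. Qed.

Lemma in_varsD A p q : in_vars A p -> in_vars A q -> in_vars A (p + q).
Proof. by move=> Hp Hq m /msuppD_le; rewrite mem_cat => /orP[/Hp|/Hq]. Qed.

Lemma in_varsM A p q : in_vars A p -> in_vars A q -> in_vars A (p * q).
Proof.
move=> Hp Hq m /msuppM_le/allpairsP[[m1 m2] /= [m1p m2q ->]] v vA.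
by rewrite mnmDE (Hp m1)// (Hq m2).
Qed.

Lemma in_vars_xvar A v : v \in A -> in_vars A (xvar v).
Proof.
move=> vA m; rewrite msuppX inE => /eqP -> u uA; rewrite mnm1E.
by case: eqP => // /enum_rank_inj[E]; rewrite -E vA in uA.
Qed.

Lemma in_vars_tvar A : in_vars A (tvar V).
Proof.
move=> m; rewrite msuppX inE => /eqP -> u uA; rewrite mnm1E.
by case: eqP => // /enum_rank_inj.
Qed.

Lemma in_vars_class_weight Z (e : {set V}) u :
  in_vars (ground Z :\: e) (class_weight Z e (@xvar V) (tvar V) u).
Proof.
apply: big_ind => [||B]; [exact: in_vars_0|exact: in_varsD|].
move=> /andP[/andP[/andP[/subsetP sB _] _] _]; apply: in_varsM.
  elim: (nullity _ _) => [|n IHn]; first exact: in_vars_1.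
  by rewrite exprS; apply: in_varsM IHn; apply: in_vars_tvar.
apply: big_ind => [||v vB]; [exact: in_vars_1|exact: in_varsM|].
by apply: in_vars_xvar; apply: sB.
Qed.

Lemma rename_xvar f v : rename f (xvar v) = xvar (f v).
Proof. by rewrite /rename comp_mpolyXU -tnth_nth tnth_mktuple enum_rankK. Qed.

Lemma rename_tvar f : rename f (tvar V) = tvar V.
Proof. by rewrite /rename comp_mpolyXU -tnth_nth tnth_mktuple enum_rankK. Qed.

Lemma rename_class_weight f Z (e : {set V}) u :
  rename f (class_weight Z e (@xvar V) (tvar V) u) =
  class_weight Z e (@xvar V \o f) (tvar V) u.
Proof.
rewrite /rename rmorph_sum; apply: eq_bigr => B _.
rewrite rmorphM rmorphXn rmorph_prod /=; congr (_ ^+ _ * _); first exact: rename_tvar.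
by apply: eq_bigr => v _; apply: rename_xvar.
Qed.

Lemma tvar_neqC (c : int) : tvar V != c%:MP.
Proof.
apply/eqP => /(congr1 (mcoeff U_(enum_rank None))).
rewrite mcoeffX eqxx mcoeffC mnm1_eq0 mulr0 => /eqP.
by rewrite oner_eq0.
Qed.

(** Adding up all equations gives [t - 1 + #|a|%:R] times the sum of the [d v], so that sum is zero;
    each equation then reduces to [(t - 1) * d u = 0]. *)
Lemma homogeneous_weights_eq0 (R : idomainType) (a : {set V}) (t : R) (d : V -> R) :
  t != 1 -> t - 1 + #|a|%:R != 0 ->
  (forall u, u \in a -> t * d u + \sum_(v in a :\ u) d v = 0) ->
  forall u, u \in a -> d u = 0.
Proof.
move=> t1 tq H.
have H' u : u \in a -> (t - 1) * d u + \sum_(v in a) d v = 0.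
  by move=> ua; rewrite -[RHS](H u ua) (big_setD1 u ua) /=; ring.
have s0 : \sum_(v in a) d v = 0.
  apply/eqP; rewrite -(mulrI_eq0 _ (lregP tq)); apply/eqP.
  transitivity (\sum_(u in a) ((t - 1) * d u + \sum_(v in a) d v)).
    rewrite big_split /= -mulr_sumr sumr_const -mulr_natl; ring.
  by apply: big1 => u /H'.
move=> u /H'/eqP; rewrite s0 addr0 mulf_eq0 subr_eq0 (negPf t1) /=.
by move/eqP.
Qed.

End Polynomials.

(** * The tensor product formula, with existence and uniqueness of the weights *)

Theorem theorem16 (V : finType) (q : nat)
  (Z1 Z2 : ranked_carrier V) (Zs : {set V} -> ranked_carrier V)
  (phi : {set V} -> V -> V) (a : {set V}) (s : seq {set V})
  (hq : (2 <= q)%N)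
  (Z1_tight : tight Z1)
  (Z1_q : forall e, e \in classes Z1 -> #|e| = q)
  (Z1_nonsing : forall e, e \in classes Z1 -> ~~ singular_class Z1 e)
  (Zs_tight : forall e, e \in classes Z1 -> tight (Zs e))
  (Zs_disjoint : forall e f, e \in classes Z1 -> f \in classes Z1 -> e != f ->
     [disjoint ground (Zs e) & ground (Zs f)])
  (Zs_align : forall e, e \in classes Z1 -> align Z1 (Zs e) e)
  (Z2_tight : tight Z2)
  (a_class : a \in classes Z2)
  (a_q : #|a| = q)
  (a_nonsing : ~~ singular_class Z2 a)
  (phi_iso : forall e, e \in classes Z1 -> is_iso (Zs e) Z2 (phi e))
  (phi_a : forall e, e \in classes Z1 -> phi e @: e = a)
  (s_enum : perm_eq s (enum (classes Z1))) :
  exists y : V -> wpoly V,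
    [/\ solves_weights Z2 a y,
        forall y', solves_weights Z2 a y' -> {in a, y' =1 y}
      & Qpoly (tensor Z1 Zs s) =
        wtrans Z1
          (fun u => let e := pblock (classes Z1) u in
             rename (inv_on (ground (Zs e)) (phi e)) (y (phi e u)))
          (tvar V)].
Proof.
pose y := class_weight Z2 a (@xvar V) (tvar V).
have p1 := tight_partition Z1_tight.
have ysol u : u \in a ->
    Qpoly (minor Z2 u) = tvar V * y u + \sum_(v in a :\ u) y v.
  by move=> ua; apply: wtrans_minor.
exists y; split.
- by split=> // u ua; apply: in_vars_class_weight.
- move=> y' [_ y'sol] u ua; apply/eqP; rewrite -subr_eq0; apply/eqP.
  (* The difference of two solutions solves the homogeneous system; [t] is a variable, so it equals
     neither [1] nor [1 - #|a|%:R]. *)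
  apply: (@homogeneous_weights_eq0 _ _ a (tvar V) (fun v => y' v - y v)) => //.
  + exact: tvar_neqC.
  + have := tvar_neqC V (1 - #|a|%:R).
    by rewrite -subr_eq0 rmorphB rmorph1 rmorph_nat opprB addrCA addrC.
  move=> v va; rewrite sumrB mulrBr addrACA -opprD -ysol// -y'sol//.
  by rewrite subrr.
have mem_s e : (e \in s) = (e \in classes Z1) by rewrite (perm_mem s_enum) mem_enum.
rewrite /Qpoly wtrans_tensor//.
- apply: eq_wtrans => u uZ.
  have [e eZ ue] := mem_ground_class p1 uZ.
  rewrite /= (def_pblock (partition_trivIset p1) eZ ue).
  rewrite (@tensor_weight_in _ _ _ _ _ _ e) ?mem_s// => [|f]; last first.
    by rewrite mem_s => fZ uf; apply: (class_eq p1 fZ eZ uf ue).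
  have [_ _ eZe _ _] := Zs_align e eZ.
  (* Renaming the weight from [Z2] along the inverse of [phi e] evaluates it at the renamed
     variables, which is the weight of [u] in [Zs e]. *)
  rewrite rename_class_weight -(phi_a e eZ) class_weight_iso//.
    exact: tight_partition (Zs_tight e eZ).
  exact: phi_iso.
- by rewrite (perm_uniq s_enum) enum_uniq.
- by move=> e; rewrite mem_s; apply: Zs_tight.
- by move=> e; rewrite mem_s; apply: Zs_align.
- by move=> e f; rewrite !mem_s; apply: Zs_disjoint.
Qed.
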